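(* The series $\sum_{k=0}^\infty (-1)^k c_k$ converges and $$\sum_{k=0}^{\infty}(-1)^k c_k=\sum_{k=1}^{\infty}\frac{1}{2^k}\,\frac{1}{\zeta(2k)}.$$
   Context: Let $\zeta$ denote the Riemann zeta function. For integers $k\ge 0$ define $$c_k=\sum_{j=0}^k (-1)^j\binom{k}{j}\frac{1}{\zeta(2j+2)}.$$ *)

(* Defs.v *)
From Stdlib Require Import Reals.
From Coquelicot Require Import Coquelicot.

Local Open Scope R_scope.

(** The Riemann zeta function on the half-line [s > 1], where it is given by
    its Dirichlet series [sum_(n >= 1) n^(-s)].  It is only evaluated at the
    even integers [2, 4, 6, ...] below; for [s <= 1] the series diverges and
    the value is meaningless. *)
Definition zeta (s : R) : R :=
  Series (fun n : nat => Rpower (INR (n + 1)) (- s)).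

(** [Binomial.C] is qualified because Coquelicot uses [C] for the complex
    numbers; [sum_n f k] is the sum of the [k + 1] terms [f 0, ..., f k]. *)
Definition c (k : nat) : R :=
  sum_n (fun j : nat =>
           (-1) ^ j * Binomial.C k j * (1 / zeta (INR (2 * j + 2)))) k.

(* Main.v *)
Require Import Defs.
From Stdlib Require Import Reals Lra Lia.
From Coquelicot Require Import Coquelicot.

Local Open Scope R_scope.

(** Both series are signed mixtures of geometric series.  With the Moebius
    function, [1 / zeta (2j + 2)] is the sum over [n >= 1] of
    [mobius n * x ^ (j + 1)], where [x = 1 / n^2] ([inv_zeta_even]).  By the
    binomial theorem, [c k] is then the sum of [mobius n * x * (1 - x) ^ k]
    ([c_moment]).  Summing the geometric series over [k] for fixed [n], with
    ratio [x - 1] on the left and [x / 2] on the right, gives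
    [mobius n * x / (2 - x)] in both cases.

    On the left the interchange of the two sums is not covered by absolute
    convergence, as the ratios [x - 1] approach [-1].  Instead, Tannery's
    theorem ([tannery]) is applied to the partial sums in [k]: they are bounded
    by a constant times [Rabs (mobius n) * x], whose sum over [n] is finite,
    and for each fixed [n] they converge ([is_series_mixed_geometric]).

    The Moebius function enters only as the inverse of the constant [1] for
    Dirichlet convolution, defined by recursion.  Everything about it comes from
    one finite identity ([sum_dirichlet_convolution]).  Applied to
    [Rabs (mobius n)] it bounds the sum of [Rabs (mobius n) / n^2]
    ([sum_mobius_invsq_le]), the point being that [zeta 2 < 2]; applied to
    [mobius] it gives, in the limit, [zeta s] times the Dirichlet series of
    [mobius] equal to [1]. *)

(** * Finite sums and series of real numbers *)

(** The restatements below fix the type of the equation to [R]: the generic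
    versions leave the carrier of an algebraic structure there, on which [ring]
    and [lra] fail. *)
Lemma sum_n_S (a : nat -> R) (n : nat) : sum_n a (S n) = sum_n a n + a (S n) :> R.
Proof. exact (sum_Sn a n). Qed.

Lemma sum_n_0 (a : nat -> R) : sum_n a 0 = a O :> R.
Proof. exact (sum_O a). Qed.

Lemma sum_n_Rplus (a b : nat -> R) (n : nat) :
  sum_n (fun k => a k + b k) n = sum_n a n + sum_n b n :> R.
Proof. exact (sum_n_plus a b n). Qed.

Lemma sum_n_Rext_loc (a b : nat -> R) (n : nat) :
  (forall k, (k <= n)%nat -> a k = b k) -> sum_n a n = sum_n b n :> R.
Proof. exact (sum_n_ext_loc a b n). Qed.

Lemma is_series_Rscal_l (r : R) (a : nat -> R) (l : R) :
  is_series a l -> is_series (fun n => r * a n) (r * l).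
Proof. exact (is_series_scal_l r a l). Qed.

Lemma is_series_Rplus (a b : nat -> R) (la lb : R) :
  is_series a la -> is_series b lb -> is_series (fun n => a n + b n) (la + lb).
Proof. exact (is_series_plus a b la lb). Qed.

Lemma is_series_sum_n (f : nat -> nat -> R) (l : nat -> R) (m : nat) :
  (forall j, is_series (f j) (l j)) ->
  is_series (fun n => sum_n (fun j => f j n) m) (sum_n l m).
Proof.
  intros H. induction m as [|m IH].
  - rewrite sum_n_0. eapply is_series_ext; [|apply (H O)].
    intros n. now rewrite sum_n_0.
  - rewrite sum_n_S. eapply is_series_ext; [|apply (is_series_Rplus _ _ _ _ IH (H (S m)))].
    intros n. now rewrite sum_n_S.
Qed.

Lemma ex_series_dominated (a b : nat -> R) :
  (forall n, Rabs (a n) <= b n) -> ex_series b -> ex_series a.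
Proof. exact (ex_series_le (V := R_CompleteNormedModule) a b). Qed.

Lemma sum_n_le (a b : nat -> R) (N : nat) :
  (forall n, (n <= N)%nat -> a n <= b n) -> sum_n a N <= sum_n b N.
Proof. intros H. rewrite !sum_n_Reals. now apply sum_Rle. Qed.

Lemma ex_series_bounded (a : nat -> R) (B : R) :
  (forall n, 0 <= a n) -> (forall N, sum_n a N <= B) -> ex_series a.
Proof.
  intros Ha HB.
  destruct (ex_finite_lim_seq_incr (sum_n a) B) as [l Hl].
  - intros n. rewrite sum_n_S. generalize (Ha (S n)). lra.
  - exact HB.
  - now exists l.
Qed.

Lemma Series_finite_support (a : nat -> R) (N : nat) :
  (forall n, (N < n)%nat -> a n = 0) -> Series a = sum_n a N.
Proof.
  intros H. apply is_series_unique.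
  apply (is_lim_seq_ext_loc (fun _ => sum_n a N) _ (sum_n a N)); [|apply is_lim_seq_const].
  exists N. intros n Hn. induction Hn as [|n Hn IH]; [reflexivity|].
  rewrite sum_n_S, H, IH by lia. now rewrite Rplus_0_r.
Qed.

(** Dominated convergence for series: beyond a large index the terms of [u N]
    and of [v] are controlled by the tail of [g], uniformly in [N], and what
    remains is a finite sum of null sequences. *)
Lemma tannery (u : nat -> nat -> R) (v g : nat -> R) :
  ex_series g ->
  (forall N n, Rabs (u N n) <= g n) ->
  (forall n, is_lim_seq (fun N => u N n) (v n)) ->
  is_lim_seq (fun N => Series (u N)) (Series v).
Proof.
  intros Hg Hu Hv.
  assert (Hvg : forall n, Rabs (v n) <= g n).
  { intros n.
    apply (is_lim_seq_le (fun N => Rabs (u N n)) (fun _ => g n)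
             (Rabs (v n)) (g n)).
    - intros N; apply Hu.
    - apply (is_lim_seq_abs _ (v n)), Hv.
    - apply is_lim_seq_const. }
  assert (Hd : forall N n, Rabs (u N n - v n) <= 2 * g n).
  { intros N n. generalize (Rabs_triang (u N n) (- v n)) (Hu N n) (Hvg n).
    rewrite Rabs_Ropp. unfold Rminus. lra. }
  assert (Eg : ex_series (fun n => 2 * g n)) by now apply (ex_series_scal 2 g).
  assert (Eu : forall N, ex_series (u N)).
  { intros N. now apply (ex_series_dominated (u N) g); [apply Hu|]. }
  assert (Ev : ex_series v) by now apply (ex_series_dominated v g).
  assert (Ed : forall N, ex_series (fun n => Rabs (u N n - v n))).
  { intros N. apply (ex_series_dominated _ (fun n => 2 * g n)); [|assumption].
    intros n. rewrite Rabs_Rabsolu. apply Hd. }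
  apply is_lim_seq_spec. intros eps. simpl.
  (* The cut-off [M] must not depend on [N]: it comes from the tail of [g]. *)
  assert (HM : exists M, forall N, Series (fun n => Rabs (u N n - v n))
       <= sum_n (fun n => Rabs (u N n - v n)) M + eps / 2).
  { assert (HS : is_lim_seq (sum_n (fun n => 2 * g n)) (Series (fun n => 2 * g n)))
      by exact (Series_correct _ Eg).
    apply is_lim_seq_spec in HS.
    destruct (HS (pos_div_2 eps)) as [M HM]. simpl in HM.
    exists M. intros N.
    rewrite (Series_incr_n _ (S M)) by (try apply Ed; lia).
    specialize (HM M (Nat.le_refl M)).
    rewrite (Series_incr_n (fun n => 2 * g n) (S M)) in HM by (try apply Eg; lia).
    simpl pred in HM |- *. rewrite <- sum_n_Reals in HM |- *.
    apply Rplus_le_compat_l.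
    apply Rle_trans with (Series (fun k => 2 * g (S M + k)%nat)).
    - apply Series_le.
      + intros n; split; [apply Rabs_pos | apply Hd].
      + now apply (ex_series_incr_n (fun n => 2 * g n) (S M)).
    - rewrite Rabs_minus_sym in HM. apply Rabs_def2 in HM. lra. }
  destruct HM as [M HM].
  assert (HF : is_lim_seq (fun N => sum_n (fun n => Rabs (u N n - v n)) M) 0).
  { assert (Hdiff : forall n, is_lim_seq (fun N => Rabs (u N n - v n)) 0).
    { intros n. rewrite <- Rabs_R0, <- (Rminus_diag (v n)).
      apply (is_lim_seq_abs _ (v n - v n)), is_lim_seq_minus';
        [apply Hv|apply is_lim_seq_const]. }
    clear HM. induction M as [|M IH].
    - apply is_lim_seq_ext with (fun N => Rabs (u N O - v O)); [|apply Hdiff].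
      intros N. now rewrite sum_n_0.
    - apply is_lim_seq_ext with
        (fun N => sum_n (fun n => Rabs (u N n - v n)) M + Rabs (u N (S M) - v (S M))).
      + intros N. now rewrite sum_n_S.
      + replace 0 with (0 + 0) by lra. now apply is_lim_seq_plus'. }
  apply is_lim_seq_spec in HF. destruct (HF (pos_div_2 eps)) as [N0 HN]. simpl in HN.
  exists N0. intros N HNN. specialize (HN N HNN). specialize (HM N).
  rewrite <- Series_minus by auto.
  eapply Rle_lt_trans; [now apply Series_Rabs|].
  rewrite Rminus_0_r in HN. apply Rabs_def2 in HN. lra.
Qed.

(** * Mixtures of geometric series *)

Lemma Rabs_pow_le1 (q : R) (j : nat) : Rabs q <= 1 -> Rabs (q ^ j) <= 1.
Proof.
  intros H. rewrite <- RPow_abs, <- (pow1 j).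
  apply pow_incr. split; [apply Rabs_pos|exact H].
Qed.

Lemma ex_series_mult_bounded (w q : nat -> R) :
  ex_series (fun n => Rabs (w n)) -> (forall n, Rabs (q n) <= 1) ->
  ex_series (fun n => w n * q n).
Proof.
  intros Hw Hq. apply (ex_series_dominated _ _) with (2 := Hw).
  intros n. rewrite Rabs_mult, <- Rmult_1_r.
  apply Rmult_le_compat_l; [apply Rabs_pos|apply Hq].
Qed.

(** Tannery's theorem applied to the partial sums
    [w n * (1 - q n ^ S K) / (1 - q n)], which are at most [4 * Rabs (w n)]
    because [1 - q n >= 1 / 2].  The endpoint [q n = -1] is where the geometric
    series oscillates, so it may only carry weight zero; values of [q] that
    accumulate at [-1] are harmless, although the double series need not then
    be absolutely convergent. *)
Lemma is_series_mixed_geometric (w q : nat -> R) :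
  ex_series (fun n => Rabs (w n)) ->
  (forall n, -1 <= q n <= 1 / 2) ->
  (forall n, w n = 0 \/ -1 < q n) ->
  is_series (fun k => Series (fun n => w n * q n ^ k))
            (Series (fun n => w n * / (1 - q n))).
Proof.
  intros Hw Hq Hq1.
  assert (Hq' : forall n, Rabs (q n) <= 1)
    by (intros n; apply Rabs_le; generalize (Hq n); lra).
  assert (Hpart : forall K,
     sum_n (fun k => Series (fun n => w n * q n ^ k)) K =
     Series (fun n => w n * sum_n (fun k => q n ^ k) K)).
  { intros K. symmetry. apply is_series_unique.
    eapply is_series_ext;
      [|apply (is_series_sum_n (fun k n => w n * q n ^ k))].
    - intros n. apply (sum_n_mult_l (K := R_Ring)).
    - intros k. apply Series_correct, ex_series_mult_bounded; [exact Hw|].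
      intros n. now apply Rabs_pow_le1. }
  assert (Hgeo : forall n K, sum_n (fun k => q n ^ k) K = (1 - q n ^ S K) * / (1 - q n)).
  { intros n K. rewrite sum_n_Reals. apply tech3. generalize (Hq n). lra. }
  apply (is_lim_seq_ext (fun K => Series (fun n => w n * sum_n (fun k => q n ^ k) K)) _
           (Series (fun n => w n * / (1 - q n)))).
  { intros K. now rewrite Hpart. }
  apply tannery with (g := fun n => Rabs (w n) * 4).
  - now apply ex_series_scal_r.
  - intros K n. rewrite Rabs_mult. apply Rmult_le_compat_l; [apply Rabs_pos|].
    rewrite Hgeo, Rabs_mult. replace 4 with (2 * 2) by lra.
    apply Rmult_le_compat; [apply Rabs_pos|apply Rabs_pos| |].
    + generalize (Rabs_triang 1 (- q n ^ S K)) (Rabs_pow_le1 (q n) (S K) (Hq' n)).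
      rewrite Rabs_Ropp, Rabs_R1. unfold Rminus. lra.
    + rewrite Rabs_pos_eq by (apply Rlt_le, Rinv_0_lt_compat; generalize (Hq n); lra).
      replace 2 with (/ / 2) by lra. apply Rinv_le_contravar; generalize (Hq n); lra.
  - intros n. destruct (Hq1 n) as [E|Hn].
    + rewrite E, Rmult_0_l. apply is_lim_seq_ext with (fun _ => 0);
        [|apply is_lim_seq_const].
      intros K. ring.
    + apply is_lim_seq_mult'; [apply is_lim_seq_const|].
      refine (is_series_geom (q n) _).
      apply Rabs_def1; generalize (Hq n); lra.
Qed.

(** * The Dirichlet inverse of the constant function 1 *)

(** Since [n mod 0 = n], the index [d = 0] does not divide any [n >= 1]. *)
Definition dvd (d n : nat) : R := if Nat.eqb (n mod d) 0 then 1 else 0.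

(** The values on [1, ..., N], extended by zero.  Keeping the whole table makes
    the course-of-values recursion structural in [N]. *)
Fixpoint mobius_upto (N : nat) : nat -> R :=
  match N with
  | O => fun _ => 0
  | S M => fun n =>
      if Nat.eqb n (S M)
      then (if Nat.eqb M 0 then 1 else 0)
           - sum_n (fun d => dvd d (S M) * mobius_upto M d) M
      else mobius_upto M n
  end.

(** The Moebius function, by its characterization [sum_dvd_mobius], and [0]
    at [0]. *)
Definition mobius (n : nat) : R := mobius_upto n n.

Lemma mobius_upto_le (N n : nat) : (n <= N)%nat -> mobius_upto N n = mobius n.
Proof.
  induction N as [|N IH]; intros H.
  - now replace n with O by lia.
  - destruct (Nat.eq_dec n (S N)) as [->|E]; [reflexivity|].
    rewrite <- IH by lia. simpl.
    now rewrite (proj2 (Nat.eqb_neq n (S N)) E).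
Qed.

Lemma mobius_0 : mobius 0 = 0.
Proof. reflexivity. Qed.

Lemma mobius_1 : mobius 1 = 1.
Proof. unfold mobius. simpl. rewrite sum_n_0. ring. Qed.

Lemma sum_dvd_mobius (n : nat) :
  (1 <= n)%nat ->
  sum_n (fun d => dvd d n * mobius d) n = (if Nat.eqb n 1 then 1 else 0) :> R.
Proof.
  destruct n as [|n]; [lia|]. intros _.
  rewrite sum_n_S. simpl.
  assert (E : mobius (S n) = (if Nat.eqb n 0 then 1 else 0)
                - sum_n (fun d => dvd d (S n) * mobius d) n).
  { unfold mobius at 1. simpl. rewrite Nat.eqb_refl. f_equal.
    apply sum_n_Rext_loc. intros d Hd. now rewrite mobius_upto_le. }
  rewrite E.
  replace (dvd (S n) (S n)) with 1 by (unfold dvd; now rewrite Nat.Div0.mod_same).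
  ring.
Qed.

(** The floor of [N / d] jumps, by one, exactly when [N] passes to a multiple
    of [d]. *)
Lemma sum_n_div_succ (h : nat -> R) (N d : nat) :
  (1 <= d)%nat ->
  sum_n h (S N / d) = sum_n h (N / d) + dvd d (S N) * h (S N / d)%nat :> R.
Proof.
  intros Hd. unfold dvd.
  generalize (Nat.div_mod_eq (S N) d) (Nat.mod_upper_bound (S N) d ltac:(lia)).
  destruct (Nat.eqb_spec (S N mod d) 0) as [E|E]; intros H1 H2.
  - rewrite E in H1.
    replace (S N / d)%nat with (S (N / d)); [rewrite sum_n_S; ring|].
    assert (E1 : (N / d = S N / d - 1)%nat).
    { symmetry. apply (Nat.div_unique N d _ (d - 1)); [lia|].
      destruct (S N / d)%nat; [lia|]. simpl. rewrite Nat.sub_0_r. lia. }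
    destruct (S N / d)%nat; lia.
  - replace (N / d)%nat with (S N / d)%nat; [now rewrite Rmult_0_l, Rplus_0_r|].
    apply (Nat.div_unique N d _ (S N mod d - 1)); lia.
Qed.

(** Writing [n = d * e], both sides sum [a d * h d * h e] over the pairs with
    [d * e <= N].  The floors make induction on [N] possible without any double
    sum.  The condition [h 0 = 0] removes the index [0], and makes the terms
    with [d > N] vanish. *)
Lemma sum_dirichlet_convolution (a h : nat -> R) (N : nat) :
  h O = 0 ->
  (forall m n, h (m * n)%nat = h m * h n) ->
  sum_n (fun n => h n * sum_n (fun d => dvd d n * a d) n) N =
  sum_n (fun d => a d * h d * sum_n h (N / d)) N :> R.
Proof.
  intros h0 hM. induction N as [|N IH].
  - rewrite !sum_n_0, h0. ring.
  - rewrite sum_n_S, IH.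
    transitivity (sum_n (fun d => a d * h d * sum_n h (N / d)
                            + h (S N) * (dvd d (S N) * a d)) (S N)).
    + rewrite sum_n_Rplus, (sum_n_S (fun d => a d * h d * sum_n h (N / d))).
      rewrite Nat.div_small, sum_n_0, h0, Rmult_0_r, Rplus_0_r by lia.
      f_equal. symmetry. apply (sum_n_mult_l (K := R_Ring)).
    + apply sum_n_Rext_loc. intros d _.
      destruct d as [|d].
      * rewrite h0. unfold dvd. simpl. ring.
      * rewrite sum_n_div_succ by lia. unfold dvd.
        destruct (Nat.eqb_spec (S N mod S d) 0) as [E|E]; [|ring].
        assert (EN : h (S N) = h (S d) * h (S N / S d)%nat).
        { rewrite <- hM. f_equal. rewrite (Nat.div_mod_eq (S N) (S d)) at 1. lia. }
        rewrite EN. ring.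
Qed.

(** * Summability of the weights *)

(** At [n = 0] this is [/ 0 = 0], as wanted for a completely multiplicative
    weight that ignores the index [0]. *)
Definition invsq (n : nat) : R := / INR n ^ 2.

Lemma invsq_0 : invsq 0 = 0.
Proof. unfold invsq. simpl. rewrite Rmult_0_l. apply Rinv_0. Qed.

Lemma invsq_1 : invsq 1 = 1.
Proof. unfold invsq. simpl. field. Qed.

Lemma invsq_pos (n : nat) : 0 < invsq (S n).
Proof.
  apply Rinv_0_lt_compat, pow_lt, lt_0_INR. lia.
Qed.

Lemma invsq_ge0 (n : nat) : 0 <= invsq n.
Proof.
  destruct n; [rewrite invsq_0; lra | apply Rlt_le, invsq_pos].
Qed.

Lemma invsq_mul (m n : nat) : invsq (m * n) = invsq m * invsq n.
Proof. unfold invsq. now rewrite mult_INR, Rpow_mult_distr, Rinv_mult. Qed.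

Lemma invsq_le1 (n : nat) : invsq n <= 1.
Proof.
  destruct n; [rewrite invsq_0; lra|].
  unfold invsq. rewrite <- Rinv_1. apply Rinv_le_contravar; [lra|].
  apply pow_R1_Rle. rewrite S_INR. generalize (pos_INR n). lra.
Qed.

(** [1 / n^2 <= 1 / (n - 1) - 1 / n], started at [n = 3]: an earlier start
    would give the bound [2], and [sum_mobius_invsq_le] needs a bound strictly
    below [2]. *)
Lemma sum_invsq_tel (N : nat) :
  sum_n invsq (S (S N)) <= 7 / 4 - / INR (S (S N)).
Proof.
  induction N as [|N IH].
  - rewrite !sum_n_S, sum_n_0, invsq_0. unfold invsq; simpl. lra.
  - rewrite sum_n_S.
    eapply Rle_trans; [apply Rplus_le_compat_r, IH|].
    unfold invsq. rewrite (S_INR (S (S N))).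
    assert (0 < INR (S (S N))) by (apply lt_0_INR; lia).
    set (x := INR (S (S N))) in *.
    assert (0 <= / x - / (x + 1) - / (x + 1) ^ 2); [|lra].
    replace (/ x - / (x + 1) - / (x + 1) ^ 2) with (/ (x * (x + 1) ^ 2))
      by (field; lra).
    apply Rlt_le, Rinv_0_lt_compat. apply Rmult_lt_0_compat; [assumption|apply pow_lt; lra].
Qed.

Lemma sum_invsq_le (N : nat) : sum_n invsq N <= 7 / 4.
Proof.
  destruct N as [|[|N]].
  - rewrite sum_n_0, invsq_0. lra.
  - rewrite sum_n_S, sum_n_0, invsq_0. unfold invsq; simpl. lra.
  - generalize (sum_invsq_tel N).
    assert (0 < / INR (S (S N))) by (apply Rinv_0_lt_compat, lt_0_INR; lia). lra.
Qed.

Lemma ex_series_invsq : ex_series invsq.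
Proof. exact (ex_series_bounded _ _ invsq_ge0 sum_invsq_le). Qed.

(** The recursion bounds [Rabs (mobius n)] by the sum over the proper divisors;
    the factor [2] appears on adding the term [d = n]. *)
Lemma Rabs_mobius_dvd (n : nat) :
  (2 <= n)%nat ->
  2 * Rabs (mobius n) <= sum_n (fun d => dvd d n * Rabs (mobius d)) n.
Proof.
  intros Hn. generalize (sum_dvd_mobius n ltac:(lia)).
  destruct n as [|n]; [lia|].
  rewrite (proj2 (Nat.eqb_neq (S n) 1)) by lia.
  rewrite !sum_n_S.
  replace (dvd (S n) (S n)) with 1 by (unfold dvd; now rewrite Nat.Div0.mod_same).
  intros H.
  replace (mobius (S n)) with (- sum_n (fun d => dvd d (S n) * mobius d) n) by lra.
  rewrite Rabs_Ropp.
  assert (Rabs (sum_n (fun d => dvd d (S n) * mobius d) n)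
          <= sum_n (fun d => dvd d (S n) * Rabs (mobius d)) n); [|lra].
  eapply Rle_trans; [apply (norm_sum_n_m (V := R_NormedModule))|].
  right. apply sum_n_m_ext. intros d. unfold norm; simpl. unfold abs; simpl.
  rewrite Rabs_mult. f_equal. apply Rabs_pos_eq. unfold dvd.
  destruct (Nat.eqb _ _); lra.
Qed.

(** Let [A] be the left-hand side.  Convolving [Rabs (mobius n)] with the
    constant [1] at least doubles it, except at [n = 1] where it stays [1]; so
    the weighted sum of the convolution is at least [2 * A - 1].  By
    [sum_dirichlet_convolution] it is at most [7 / 4 * A].  Hence
    [A <= 4]. *)
Lemma sum_mobius_invsq_le (N : nat) :
  sum_n (fun d => Rabs (mobius d) * invsq d) N <= 4.
Proof.
  set (A := sum_n (fun d => Rabs (mobius d) * invsq d) N).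
  assert (H1 : sum_n (fun d => Rabs (mobius d) * invsq d * sum_n invsq (N / d)) N
               <= A * (7 / 4)).
  { unfold A. rewrite <- (sum_n_mult_r (K := R_Ring)). apply sum_n_le.
    intros d _. apply Rmult_le_compat_l; [|apply sum_invsq_le].
    apply Rmult_le_pos; [apply Rabs_pos|apply invsq_ge0]. }
  assert (H2 : 2 * A - 1 <= sum_n (fun n => invsq n *
                 sum_n (fun d => dvd d n * Rabs (mobius d)) n) N).
  { unfold A. clear. induction N as [|N IH].
    - rewrite !sum_n_0, invsq_0. lra.
    - destruct N as [|N].
      + rewrite !sum_n_S, !sum_n_0, mobius_0, mobius_1, Rabs_R0, Rabs_R1.
        rewrite invsq_0, invsq_1. unfold dvd. simpl. lra.
      + rewrite !(sum_n_S _ (S N)).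
        assert (invsq (S (S N)) * (2 * Rabs (mobius (S (S N)))) <=
           invsq (S (S N)) * sum_n (fun d => dvd d (S (S N)) * Rabs (mobius d)) (S (S N))).
        { apply Rmult_le_compat_l; [apply invsq_ge0|apply Rabs_mobius_dvd; lia]. }
        rewrite (sum_n_S _ (S N)) in H. lra. }
  rewrite (sum_dirichlet_convolution (fun d => Rabs (mobius d)) invsq N invsq_0 invsq_mul) in H2.
  lra.
Qed.

Lemma ex_series_mobius : ex_series (fun n => Rabs (mobius n * invsq n)).
Proof.
  apply (ex_series_bounded _ 4); [intros; apply Rabs_pos|].
  intros N. eapply Rle_trans; [right|apply (sum_mobius_invsq_le N)].
  apply sum_n_Rext_loc. intros n _. rewrite Rabs_mult. f_equal.
  apply Rabs_pos_eq, invsq_ge0.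
Qed.

Lemma Rabs_invsq_le1 (n : nat) : Rabs (invsq n) <= 1.
Proof. rewrite Rabs_pos_eq; [apply invsq_le1|apply invsq_ge0]. Qed.

(** * Moment representations *)

Lemma zeta_even (j : nat) :
  zeta (INR (2 * j + 2)) = Series (fun n => invsq n ^ S j).
Proof.
  rewrite (Series_incr_1_aux (fun n => invsq n ^ S j)).
  - unfold zeta. apply Series_ext. intros n.
    rewrite Nat.add_1_r, Rpower_Ropp, Rpower_pow by (apply lt_0_INR; lia).
    unfold invsq. rewrite pow_inv, <- pow_mult. do 2 f_equal. lia.
  - rewrite invsq_0. apply pow_ne_zero. lia.
Qed.

(** The truncation of [zeta s] times the Dirichlet series of [mobius] to pairs
    with product at most [N] is exactly [1], and Tannery's theorem lets [N]
    tend to infinity.  The exponent is split as [1 + j] because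
    [mobius n * invsq n] is the summable weight common to all [j], and
    [invsq n ^ j] the moment. *)
Lemma inv_zeta_even (j : nat) :
  1 / zeta (INR (2 * j + 2)) = Series (fun n => mobius n * invsq n * invsq n ^ j).
Proof.
  set (h := fun n => invsq n ^ S j).
  assert (h0 : h O = 0) by (unfold h; rewrite invsq_0; apply pow_ne_zero; lia).
  assert (hM : forall m n, h (m * n)%nat = h m * h n).
  { intros m n. unfold h. now rewrite invsq_mul, Rpow_mult_distr. }
  assert (hpos : forall n, 0 <= h n) by (intros; apply pow_le, invsq_ge0).
  assert (hle : forall n, h n <= invsq n).
  { intros n. unfold h. simpl. rewrite <- Rmult_1_r. apply Rmult_le_compat_l; [apply invsq_ge0|].
    eapply Rle_trans; [apply Rle_abs|apply Rabs_pow_le1, Rabs_invsq_le1]. }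
  assert (Hex : ex_series h).
  { apply (ex_series_dominated h invsq); [|apply ex_series_invsq].
    intros n. rewrite Rabs_pos_eq; auto. }
  rewrite zeta_even. fold h.
  set (u := fun N d => mobius d * h d * sum_n h (N / d)).
  assert (Hlim : is_lim_seq (fun N => Series (u N))
                   (Series (fun d => mobius d * h d * Series h))).
  { apply tannery with (g := fun d => Rabs (mobius d * invsq d) * (7 / 4)).
    - apply ex_series_scal_r, ex_series_mobius.
    - intros N d. unfold u. rewrite !Rabs_mult.
      apply Rmult_le_compat; [apply Rmult_le_pos; apply Rabs_pos|apply Rabs_pos| |].
      + apply Rmult_le_compat_l; [apply Rabs_pos|].
        rewrite !Rabs_pos_eq; [apply hle|apply invsq_ge0|apply hpos].
      + rewrite Rabs_pos_eq by (rewrite sum_n_Reals; now apply cond_pos_sum).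
        eapply Rle_trans; [|apply (sum_invsq_le (N / d))]. now apply sum_n_le.
    - intros [|d].
      + unfold u. apply is_lim_seq_ext with (fun _ => 0).
        * intros N. rewrite mobius_0. ring.
        * rewrite mobius_0, !Rmult_0_l. apply is_lim_seq_const.
      + unfold u. apply is_lim_seq_mult'; [apply is_lim_seq_const|].
        apply (is_lim_seq_subseq (sum_n h) _ (fun N => (N / S d)%nat)).
        * intros P [M HM]. exists (M * S d)%nat. intros N HN. apply HM.
          apply Nat.div_le_lower_bound; lia.
        * exact (Series_correct h Hex). }
  assert (Hone : forall N, Series (u (S N)) = 1).
  { intros N. rewrite (Series_finite_support (u (S N)) (S N)).
    - unfold u. rewrite <- (sum_dirichlet_convolution mobius h (S N) h0 hM).
      clear -h0. induction N as [|N IH].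
      + rewrite (sum_n_S _ O), sum_n_0, h0, (sum_dvd_mobius 1) by lia.
        unfold h. rewrite invsq_1, pow1. simpl. ring.
      + rewrite sum_n_S, IH, (sum_dvd_mobius (S (S N))) by lia. simpl. ring.
    - intros n Hn. unfold u. rewrite Nat.div_small by lia.
      rewrite sum_n_0, h0. ring. }
  apply is_lim_seq_incr_1 in Hlim.
  apply (is_lim_seq_ext _ (fun _ => 1)) in Hlim; [|exact Hone].
  apply is_lim_seq_unique in Hlim. rewrite Lim_seq_const in Hlim.
  rewrite Series_scal_r in Hlim. injection Hlim as Hlim.
  replace (Series (fun n => mobius n * invsq n * invsq n ^ j))
    with (Series (fun d => mobius d * h d)).
  - assert (Series h <> 0) by (intros E; rewrite E in Hlim; lra).
    rewrite Hlim. field. assumption.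
  - apply Series_ext. intros n. unfold h. simpl. ring.
Qed.

(** The binomial theorem: finite differences of a moment sequence are moments
    of [1 - x]. *)
Lemma c_moment (k : nat) :
  c k = Series (fun n => mobius n * invsq n * (1 - invsq n) ^ k).
Proof.
  symmetry. apply is_series_unique.
  unfold c.
  eapply is_series_ext;
    [|apply (is_series_sum_n (fun j n => (-1) ^ j * Binomial.C k j
                                * (mobius n * invsq n * invsq n ^ j)))].
  2: { intros j. apply is_series_Rscal_l. rewrite inv_zeta_even.
       apply Series_correct, ex_series_mult_bounded; [apply ex_series_mobius|].
       intros n. apply Rabs_pow_le1, Rabs_invsq_le1. }
  intros n. cbv beta.
  replace (1 - invsq n) with (- invsq n + 1) by ring.
  rewrite binomial, <- sum_n_Reals, <- (sum_n_mult_l (K := R_Ring)).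
  apply sum_n_Rext_loc. intros j _. unfold mult; simpl. rewrite pow1.
  replace (- invsq n) with (-1 * invsq n) by ring. rewrite Rpow_mult_distr. ring.
Qed.

(** * Comparison of the two series *)

Theorem mainTheorem4 :
  ex_series (fun k : nat => (-1) ^ k * c k) /\
  ex_series (fun k : nat => 1 / 2 ^ (k + 1) * (1 / zeta (INR (2 * (k + 1))))) /\
  Series (fun k : nat => (-1) ^ k * c k) =
  Series (fun k : nat => 1 / 2 ^ (k + 1) * (1 / zeta (INR (2 * (k + 1))))).
Proof.
  set (l := Series (fun n => mobius n * invsq n * / (2 - invsq n))).
  assert (H1 : is_series (fun k => (-1) ^ k * c k) l).
  { unfold l.
    rewrite (Series_ext _ (fun n => mobius n * invsq n * / (1 - (invsq n - 1))))
      by (intros n; do 2 f_equal; ring).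
    eapply is_series_ext; [|apply (is_series_mixed_geometric (fun n => mobius n * invsq n)
                                 (fun n => invsq n - 1))].
    - intros k. rewrite c_moment, <- Series_scal_l. apply Series_ext. intros n.
      replace (invsq n - 1) with (-1 * (1 - invsq n)) by ring.
      rewrite Rpow_mult_distr. ring.
    - exact ex_series_mobius.
    - intros n. generalize (invsq_ge0 n) (invsq_le1 n). lra.
    (* [q 0 = -1], but [mobius 0 = 0] *)
    - intros [|n].
      + left. now rewrite mobius_0, Rmult_0_l.
      + right. generalize (invsq_pos n). lra. }
  assert (H2 : is_series
    (fun k => 1 / 2 ^ (k + 1) * (1 / zeta (INR (2 * (k + 1))))) l).
  { unfold l.
    rewrite (Series_ext _ (fun n => / 2 * (mobius n * invsq n * / (1 - invsq n / 2))))
      by (intros n; generalize (invsq_le1 n); intros; field; lra).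
    rewrite Series_scal_l.
    eapply is_series_ext;
      [|apply (is_series_Rscal_l (/ 2)), (is_series_mixed_geometric
        (fun n => mobius n * invsq n) (fun n => invsq n / 2))].
    - intros k. cbv beta. replace (2 * (k + 1))%nat with (2 * k + 2)%nat by lia.
      rewrite inv_zeta_even, <- !Series_scal_l. apply Series_ext. intros n.
      unfold Rdiv. rewrite Rpow_mult_distr, pow_inv, Nat.add_1_r. simpl.
      field. apply pow_nonzero. lra.
    - exact ex_series_mobius.
    - intros n. generalize (invsq_ge0 n) (invsq_le1 n). lra.
    - intros n. right. generalize (invsq_ge0 n). lra. }
  split; [now exists l|]. split; [now exists l|].
  now rewrite (is_series_unique _ _ H1), (is_series_unique _ _ H2).
Qed.
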